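(* Let $J\in\{[0,\infty),\mathbb{R}\}$, let $X$ be a real Banach space and let $E=X\oplus iX$ be its complexification. Let $\mathfrak{g}(t)=e^{it^2}$ for $t\in\mathbb{R}$, and let $$G=\{\phi\in E^J: (T\phi)(s,\cdot)\in UC(J,E)\text{ for all } s>0\}.$$ Then $$G=BUC(J,E)+\frac{\Delta C_0(J,E)}{\mathfrak{g}}=\{\phi\in E^J:(T\phi)(s,\cdot)\in BUC(J,E)\text{ for all }s>0\}.$$
   Context: $E^J$ is the set of all functions $J\to E$. $E=X\oplus iX$ is the complex linear space with multiplication $(a+ib)(y_1+iy_2)=(ay_1-by_2)+i(by_1+ay_2)$, endowed with the (product) topology of the norm $\|y_1+iy_2\|=\max\{\|y_1\|,\|y_2\|\}$ (or any of the equivalent norms $(\|y_1\|^p+\|y_2\|^p)^{1/p}$, $1\le p<\infty$). For $f:J\to E$ and $s>0$, $(\Delta_s f)(t)=f(t+s)-f(t)$. For $\phi:J\to E$ and $s,t\in J$, $$(T\phi)(s,t)=e^{i(s^2+2st)}\phi(s+t)-\phi(t)=\frac{1}{\mathfrak{g}(t)}\Delta_s(\mathfrak{g}\phi)(t).$$ $UC(J,E)$, $BUC(J,E)$, $C_0(J,E)$ denote the spaces of uniformly continuous (not necessarily bounded), bounded uniformly continuous, and continuous vanishing at infinity functions $J\to E$; $\Delta C_0(J,E)=\{\phi\in L^1_{loc}(J,E): \Delta_h\phi\in C_0(J,E)\text{ for all }h>0\}$, and $\frac{\Delta C_0(J,E)}{\mathfrak{g}}=\{\xi/\mathfrak{g}:\xi\in\Delta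 C_0(J,E)\}$. *)

(* Defs.v *)
From HB Require Import structures.
From mathcomp Require Import all_boot all_order all_algebra.
From mathcomp Require Import complex.
From mathcomp Require Import all_classical all_reals all_analysis.

Set Implicit Arguments.
Unset Strict Implicit.
Unset Printing Implicit Defensive.

Import Order.TTheory GRing.Theory Num.Theory.
Import numFieldNormedType.Exports.

Local Open Scope classical_set_scope.
Local Open Scope ring_scope.
Local Open Scope complex_scope.

(* [complexification X] is X (+) iX, with (y1, y2) standing for y1 + i y2.
   Norm, topology and uniformity are those of X * X, whose norm is
   max(|y1|, |y2|).  This norm is not homogeneous over R[i]: the type is an
   R[i]-module and a normed additive group, but not a normed R[i]-module. *)
Definition complexification (R : realType) (X : normedModType R) : Type :=
  (X * X)%type.

Section Complexification.
Variables (R : realType) (X : normedModType R).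

#[warnings="-redundant-canonical-projection"]
HB.instance Definition _ :=
  PseudoMetricNormedZmod.copy (complexification X) (X * X)%type.

Definition complexification_scale (z : R[i]) (y : complexification X) :
    complexification X :=
  (complex.Re z *: y.1 - complex.Im z *: y.2,
   complex.Im z *: y.1 + complex.Re z *: y.2).

Fact complexification_scaleA a b v :
  complexification_scale a (complexification_scale b v) =
  complexification_scale (a * b) v.
Proof.
case: a b v => [a1 a2] [b1 b2] [x y]; rewrite /complexification_scale /=.
congr pair; rewrite !scalerBr !scalerDr !scalerA !(scalerBl, scalerDl).
- by rewrite !opprD [LHS]addrACA.
- by rewrite [LHS]addrACA; congr (_ + _); rewrite addrC.
Qed.

Fact complexification_scale1 : left_id 1 complexification_scale.
Proof.
by case=> x y; rewrite /complexification_scale /= !scale1r !scale0r subr0 add0r.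
Qed.

Fact complexification_scaleDr : right_distributive complexification_scale +%R.
Proof.
case=> a b [x y] [x' y']; rewrite /complexification_scale /= !scalerDr.
by congr pair; rewrite /= ?opprD addrACA.
Qed.

Fact complexification_scaleDl v :
  {morph complexification_scale^~ v : a b / a + b}.
Proof.
case: v => x y [a1 a2] [b1 b2]; rewrite /complexification_scale /= !scalerDl.
by congr pair; rewrite /= ?opprD addrACA.
Qed.

#[warnings="-redundant-canonical-projection"]
HB.instance Definition _ := GRing.Zmodule_isLmodule.Build R[i]
  (complexification X) complexification_scaleA complexification_scale1
  complexification_scaleDr complexification_scaleDl.

End Complexification.

(* Elements of E^J are represented by total functions R -> E of which only the
   values on J matter: every predicate and set below depends only on the
   restriction to J of the functions involved. *)
Section FunctionSpaces.
Variables (R : realType) (X : normedModType R).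
Local Notation E := (complexification X).
Implicit Types (J : set R) (f phi xi : R -> E).

Definition UC J : set (R -> E) :=
  [set f | unif_continuous (f : subspace J -> E)].

Definition BUC J : set (R -> E) :=
  [set f | UC J f /\ [bounded f t | t in J]].

Definition C0 J : set (R -> E) :=
  [set f | {within J, continuous f} /\
    forall e : R, 0 < e -> exists M : R,
      forall t, J t -> M < `|t| -> `|f t| < e].

Definition simple_fun (f : R -> E) :=
  finite_set (range f) /\ forall y, measurable (f @^-1` [set y]).

(* Strong (Bochner) measurability on J.  The simple functions are Borel
   measurable, but since convergence is only almost everywhere this is
   measurability with respect to the Lebesgue sigma-algebra. *)
Definition strongly_measurable J f :=
  exists2 f_ : nat -> R -> E, forall n, simple_fun (f_ n) &
    {ae @lebesgue_measure R, forall t, J t -> f_ ^~ t @ \oo --> f t}.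

Definition L1loc J : set (R -> E) :=
  [set f | strongly_measurable J f /\
    forall K : set R, compact K -> K `<=` J ->
      (\int[lebesgue_measure]_(t in K) (`|f t|)%:E < +oo)%E].

Definition Delta (s : R) f : R -> E := fun t => f (t + s) - f t.

Definition DeltaC0 J : set (R -> E) :=
  [set xi | L1loc J xi /\ forall h, 0 < h -> C0 J (Delta h xi)].

Definition expi (x : R) : R[i] := cos x +i* sin x.

Definition frakg (t : R) : R[i] := expi (t ^+ 2).

Definition T_op phi (s t : R) : E :=
  expi (s ^+ 2 + 2 * s * t) *: phi (s + t) - phi t.

Lemma expiD x y : expi (x + y) = expi x * expi y.
Proof.
apply/eqP; rewrite eq_complex /= cosD sinD eqxx /=.
by rewrite addrC [cos x * _]mulrC [sin x * _]mulrC mulrC.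
Qed.

Lemma expi_neq0 x : expi x != 0.
Proof.
apply/eqP => e0; have := expiD x (- x).
rewrite e0 mul0r subrr /expi cos0 sin0 => /eqP.
by rewrite eq_complex /= oner_eq0.
Qed.

Lemma T_opE phi s t :
  T_op phi s t = (frakg t)^-1 *: Delta s (fun u => frakg u *: phi u) t.
Proof.
rewrite /T_op /Delta scalerBr !scalerA mulVf ?expi_neq0// scale1r (addrC s t).
congr (_ *: _ - _); rewrite /frakg sqrrD -addrA [in RHS]expiD mulKf ?expi_neq0//.
by rewrite addrC -mulrA mulr_natl [t * s]mulrC.
Qed.

Definition DeltaC0_div_frakg J : set (R -> E) :=
  [set phi | exists2 xi, DeltaC0 J xi &
    forall t, J t -> phi t = (frakg t)^-1 *: xi t].

Definition fun_sum J (A B : set (R -> E)) : set (R -> E) :=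
  [set phi | exists u v, [/\ A u, B v & forall t, J t -> phi t = u t + v t]].

Definition G_space J : set (R -> E) :=
  [set phi | forall s, 0 < s -> UC J (T_op phi s)].

Definition G_BUC_space J : set (R -> E) :=
  [set phi | forall s, 0 < s -> BUC J (T_op phi s)].

End FunctionSpaces.

Arguments UC {R} X J _.
Arguments BUC {R} X J _.
Arguments C0 {R} X J _.
Arguments L1loc {R} X J _.
Arguments DeltaC0 {R} X J _.
Arguments DeltaC0_div_frakg {R} X J _.
Arguments G_space {R} X J _.
Arguments G_BUC_space {R} X J _.

(* Main.v *)
Require Import Defs.
From HB Require Import structures.
From mathcomp Require Import all_boot all_order all_algebra.
From mathcomp Require Import complex.
From mathcomp Require Import all_classical all_reals all_analysis.
From mathcomp Require Import ring lra.

Import Order.TTheory GRing.Theory Num.Theory.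
Import numFieldNormedType.Exports.

Local Open Scope classical_set_scope.
Local Open Scope ring_scope.

(* Put [psi = g phi], [rho t = (pi/2) / (1 + |t|)] and
   [h s = T phi (s, .) = g^-1 Delta_s psi].  As [2 t (rho t) -> +- pi] when
   [|t| -> oo], for every bounded uniformly continuous [f] the sum
   [(g f) t + (g f) (t + rho t)] tends to 0; so increments of [psi] cancel
   asymptotically between the two points [t] and [t + rho t].  Hence
   [xi t = (psi t + psi (t + rho t)) / 2] lies in Delta C0, and
   [u t = phi t - xi t / g t = - h (rho t) t / 2] lies in BUC.

   For this one needs [h s] to be equibounded and equicontinuous for
   [0 < s <= 2].  Boundedness of each [h s] follows from the cocycle relation
   [h (s + r) t = e^(i (s^2 + 2 s t)) h r (t + s) + h s t], whose rotation
   factor is incompatible with uniform continuity of large values.  The same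
   cancellation exhibits [psi - psi 0] as a pointwise limit of combinations of
   the continuous increments of [psi], so by Baire [psi] has points of arbitrarily small oscillation,
   and therefore is continuous because its increments are.  Now
   ``[h s] is bounded by n and has modulus 1/n at e'' is a closed condition on
   [s]; by Baire it holds on an interval of [s], and the cocycle relation moves
   that interval over ]0, 2]. *)

Set Implicit Arguments.
Unset Strict Implicit.

(** * Lipschitz bounds for sine and cosine; the phase [expi] *)

Section Trigonometry.
Variable R : realType.
Implicit Types x y : R.

Lemma lipschitz_derive1_le1 (f df : R -> R) :
  (forall x, is_derive x 1 f (df x)) -> (forall x, `|df x| <= 1) ->
  forall x y, `|f x - f y| <= `|x - y|.
Proof.
move=> fdf df1.
suff H x y : x <= y -> `|f x - f y| <= `|x - y|.
  move=> x y; have [/H//|/ltW/H] := leP x y.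
  by rewrite distrC (distrC y).
move=> xy; have cf : {within `[x, y], continuous f}.
  apply: continuous_subspaceT => z; apply: differentiable_continuous.
  exact/derivable1_diffP/(@ex_derive _ _ _ _ _ _ _ (fdf z)).
have [c _ Hc] := MVT_segment xy (fun z _ => fdf z) cf.
rewrite distrC Hc normrM (distrC x) ler_piMl//.
Qed.

Lemma norm_sinB x y : `|sin x - sin y| <= `|x - y|.
Proof. exact: lipschitz_derive1_le1 (@is_derive_sin R) (@cos_max R) x y. Qed.

Lemma norm_cosB x y : `|cos x - cos y| <= `|x - y|.
Proof.
apply: (@lipschitz_derive1_le1 cos (fun z => - sin z)) => z.
by rewrite normrN sin_max.
Qed.

Lemma expi0 : expi (0 : R) = 1.
Proof. by rewrite /expi cos0 sin0. Qed.

Lemma expiN x : expi (- x) = (expi x)^-1.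
Proof.
by apply: (mulfI (expi_neq0 x)); rewrite -expiD subrr expi0 divff// expi_neq0.
Qed.

Lemma expi_pi : expi (pi : R) = -1.
Proof. by apply/eqP; rewrite eq_complex /= cospi sinpi oppr0 !eqxx. Qed.

End Trigonometry.

(** * Norm and continuity of rotations on the complexification *)

Section ComplexificationNorm.
Variables (R : realType) (X : normedModType R).
Local Notation E := (complexification X).
Implicit Types (v w : E) (x y : R) (z : R[i]).

Lemma complexification_normE v : `|v| = Num.max `|v.1| `|v.2|.
Proof. by []. Qed.

Lemma norm_scale_le z v : `|z *: v| <= (`|complex.Re z| + `|complex.Im z|) * `|v|.
Proof.
have v1 : `|v.1| <= `|v| by rewrite complexification_normE le_max lexx.
have v2 : `|v.2| <= `|v| by rewrite complexification_normE le_max lexx orbT.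
rewrite [X in X <= _]complexification_normE ge_max mulrDl; apply/andP; split.
  by rewrite (le_trans (ler_normB _ _))// !normrZ lerD// ler_wpM2l.
by rewrite [leRHS]addrC (le_trans (ler_normD _ _))// !normrZ lerD// ler_wpM2l.
Qed.

(* The max norm is not invariant under rotations, hence the factors 2 below. *)
Lemma norm_expi_le x v : `|expi x *: v| <= 2 * `|v|.
Proof.
apply: le_trans (norm_scale_le _ _) _; rewrite ler_wpM2r//=.
by have := cos_max x; have := sin_max x; lra.
Qed.

Lemma norm_le_expi x v : `|v| <= 2 * `|expi x *: v|.
Proof.
by rewrite -{1}[v](scalerK (expi_neq0 x)) -expiN norm_expi_le.
Qed.

Lemma norm_expiB_le x y v : `|expi x *: v - expi y *: v| <= 2 * `|x - y| * `|v|.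
Proof.
rewrite -scalerBl; apply: le_trans (norm_scale_le _ _) _; rewrite ler_wpM2r//=.
by have := norm_cosB x y; have := norm_sinB x y; lra.
Qed.

Lemma norm_expi_dist_le x y v w :
  `|expi x *: v - expi y *: w| <= 2 * `|v - w| + 2 * `|x - y| * `|w|.
Proof.
rewrite (le_trans (ler_distD (expi x *: w) _ _))// -scalerBr.
by rewrite lerD ?norm_expi_le ?norm_expiB_le.
Qed.

Lemma continuous_expi_scale (f : R -> E) (p : R -> R) :
  continuous p -> continuous f -> continuous (fun t => expi (p t) *: f t).
Proof.
move=> cp cf t.
have c1 : (f u).1 @[u --> t] --> (f t).1 by apply: cvg_comp (cf t) cvg_fst.
have c2 : (f u).2 @[u --> t] --> (f t).2 by apply: cvg_comp (cf t) cvg_snd.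
have cc : cos (p u) @[u --> t] --> cos (p t).
  by apply: continuous_comp (cp t) (@continuous_cos R _).
have cs : sin (p u) @[u --> t] --> sin (p t).
  by apply: continuous_comp (cp t) (@continuous_sin R _).
rewrite /continuous_at.
have h1 :=  cvgB (cvgZ cc c1) (cvgZ cs c2).
have h2 := cvgD (cvgZ cs c1) (cvgZ cc c2).
exact: (cvg_pair (h1 _ _ _) (h2 _ _ _)).
Qed.

End ComplexificationNorm.

(** * Epsilon-delta forms of continuity and uniform continuity *)

Section MetricForms.
Variables (R : realType) (X : normedModType R) (J : set R).
Local Notation E := (complexification X).
Implicit Types (f : R -> E).

Lemma UCP f : UC X J f <-> forall e : R, 0 < e -> exists2 d : R, 0 < d &
  forall x y, J x -> J y -> `|x - y| < d -> `|f x - f y| < e.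
Proof.
rewrite /UC /= unif_continuousP; split => H e e0.
  have [d d0 K] := H e e0; exists d => // x y Jx Jy xy.
  have := K (x, y); rewrite /= ball_subspace_ball /subspace_ball mem_set//.
  rewrite -!ball_normE/=.
by apply; split => //.
have [d d0 K] := H e e0; exists d => // -[x y] /=.
rewrite ball_subspace_ball /subspace_ball; case: ifPn => [/set_mem Jx|_ /= ->].
  rewrite -!ball_normE/= => -[Jy]. exact: (K x y Jx Jy).
exact: ballxx.
Qed.

Lemma within_continuousP f : {within J, continuous f} <->
  forall (x e : R), J x -> 0 < e -> exists2 d : R, 0 < d &
  forall y, J y -> `|x - y| < d -> `|f x - f y| < e.
Proof.
rewrite subspace_continuousP; split => H x.
  move=> e Jx e0; have /cvgrPdist_lt/(_ e e0) := H x Jx.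
  rewrite /within/= => /nbhs_ballP[d d0 K]; exists d => // y Jy xy.
  by apply: K => //; rewrite -ball_normE.
move=> Jx; apply/cvgrPdist_lt => e e0; have [d d0 K] := H x e Jx e0.
apply/nbhs_ballP; exists d => // y; rewrite -ball_normE/= => xy Jy.
exact: K.
Qed.

Lemma continuousP_dist f : continuous f <->
  forall (x e : R), 0 < e -> exists2 d : R, 0 < d &
  forall y, `|x - y| < d -> `|f x - f y| < e.
Proof.
split => H x.
  move=> e e0; have /cvgrPdist_lt/(_ e e0)/nbhs_ballP[d d0 K] := H x.
  by exists d => // y xy; apply: K; rewrite -ball_normE.
apply/cvgrPdist_lt => e e0; have [d d0 K] := H x e e0.
by apply/nbhs_ballP; exists d => // y; rewrite -ball_normE/=; exact: K.
Qed.

(** Heine-Cantor with only [x] confined to the segment, so that [y] may leave it. *)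
Lemma continuous_unif_on_segment f (M e : R) : continuous f -> 0 < e ->
  exists2 d : R, 0 < d &
  forall x y, `|x| <= M -> `|x - y| < d -> `|f x - f y| < e.
Proof.
move=> cf e0.
have := @segment_compact R (- M) M.
move=> /compact_near_coveringP/(_ R (nbhs 0^'+)
  (fun d x => forall y, `|x - y| < d -> `|f x - f y| < e)).
move=> /(_ _)[].
  move=> x _; have e20 : 0 < e / 2 by rewrite divr_gt0.
  have [d d0 K] := (continuousP_dist f).1 cf x _ e20.
  exists (ball x (d / 2), [set r | r < d / 2]) => /=.
    split; first by apply: nbhsx_ballx; rewrite divr_gt0.
    by apply: nbhs_right_lt; rewrite divr_gt0.
  move=> [x' r] /= [+ rd] y x'y; rewrite -ball_normE/= => xx'.
  have h1 : `|f x - f x'| < e / 2 by apply: K; lra.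
  have h2 : `|f x - f y| < e / 2.
    by apply: K; rewrite (le_lt_trans (ler_distD x' _ _))//; lra.
  by rewrite (le_lt_trans (ler_distD (f x) _ _))// (distrC (f x')); lra.
move=> r /= r0 K; exists (r / 2); first by rewrite divr_gt0.
move=> x y xM; apply: (K (r / 2)).
- by rewrite /ball/= sub0r normrN gtr0_norm ?divr_gt0//; lra.
- by rewrite divr_gt0.
- by rewrite /= in_itv/= -ler_norml.
Qed.

End MetricForms.

(** Baire: if no [A n] contained such a segment, the complements of the [A n] cut down to [[a, b]]
    would be open and dense, and their intersection would meet []a, b[] outside every [A n]. *)
Lemma closed_cover_itv (R : realType) (A : nat -> set R) (a b : R) :
  a < b -> (forall n, closed (A n)) -> `]a, b[ `<=` \bigcup_n A n ->
  exists n c d, [/\ a < c, c < d, d < b & `[c, d] `<=` A n].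
Proof.
move=> ab clA cover; apply: contrapT => noitv.
pose F n := ~` (A n `&` `[a, b]%classic).
have dF : dense (\bigcap_n F n).
  apply: (@Baire R R^o) => n; split.
    by apply: closed_openC; apply: closedI => //; exact: interval_closed.
  move=> U [x Ux] oU; apply: contrapT => /set0P/negP; rewrite negbK => /eqP UF.
  have UA : U `<=` A n `&` `[a, b]%classic.
    by move=> y Uy; apply: contrapT => nAy; have : (U `&` F n) y by []; rewrite UF.
  have /nbhs_ballP[e /= e0 xeU] : nbhs x U by exact: open_nbhs_nbhs.
  have xe y : `|x - y| < e -> U y by move=> xy; apply: xeU; rewrite -ball_normE.
  (* [x - e / 2] and [x + e / 2] lie in [[a, b]], so the segment of radius [e / 4] is strictly
     inside. *)
  have := UA _ (xe (x - e / 2) _); rewrite opprB addrC subrK ger0_norm; last lra.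
  move=> /(_ _)[|_]; first lra; rewrite /= in_itv/= => /andP[h1 _].
  have := UA _ (xe (x + e / 2) _).
  rewrite opprD addrA subrr sub0r normrN ger0_norm; last lra.
  move=> /(_ _)[|_]; first lra; rewrite /= in_itv/= => /andP[_ h2].
  apply: noitv; exists n, (x - e / 4), (x + e / 4); split; [lra..|].
  move=> y; rewrite /= in_itv/= => /andP[y1 y2].
  suff /UA[] : U y by [].
  by apply: xe; rewrite ltr_norml; apply/andP; split; lra.
have [|//|y [yab yF]] := dF `]a, b[%classic.
- by exists ((a + b) / 2); rewrite /= in_itv/=; apply/andP; split; lra.
- have [n _ Any] := cover _ yab; apply: (yF n) => //; split => //.
  by move: yab; rewrite /= !in_itv/= => /andP[? ?]; apply/andP; split; lra.
Qed.

(** * Phase of [frakg] under the shift by [rho] *)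

Section PhaseShift.
Variables (R : realType) (X : normedModType R).
Local Notation E := (complexification X).
Implicit Types (v w : E) (s t x : R).

Lemma frakgV t : (frakg t)^-1 = expi (- t ^+ 2).
Proof. by rewrite expiN. Qed.

Lemma norm_frakgV_le t v : `|(frakg t)^-1 *: v| <= 2 * `|v|.
Proof. by rewrite frakgV norm_expi_le. Qed.

(* Chosen so that the phase of [frakg] moves by [pi + o(1)] between [t] and
   [t + rho t], with [t + rho t >= t] whatever the sign of [t]. *)
Definition rho t : R := pi / 2 / (1 + `|t|).

Lemma rho_gt0 t : 0 < rho t.
Proof. by rewrite /rho !divr_gt0 ?pi_gt0// ltr_pwDl. Qed.

Lemma rho_le t : rho t * (1 + `|t|) <= 2.
Proof.
rewrite /rho -mulrA mulVf ?mulr1; last by rewrite gt_eqF// ltr_pwDl.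
by case/andP: (@pihalf_02 R) => _ /ltW.
Qed.

Lemma rho_le2 t : rho t <= 2.
Proof.
apply: le_trans (rho_le t); rewrite -[leLHS]mulr1 ler_wpM2l ?lerDl//.
exact/ltW/rho_gt0.
Qed.

(** A difference of reciprocals gains both denominators: one is absorbed by the weight in
    [psi_slowly_varying], the other gives the decay needed in [Delta_slow_part_C0]. *)
Lemma rho_dist s t : `|rho s - rho t| * (1 + `|s|) * (1 + `|t|) <= 2 * `|s - t|.
Proof.
have a0 : 0 < 1 + `|s| by rewrite ltr_pwDl.
have b0 : 0 < 1 + `|t| by rewrite ltr_pwDl.
have -> : rho s - rho t = pi / 2 * (`|t| - `|s|) / ((1 + `|s|) * (1 + `|t|)).
  by rewrite /rho; field; rewrite !gt_eqF.
rewrite normrM normfV (gtr0_norm (mulr_gt0 a0 b0)) -!mulrA mulVf ?mulr1; last first.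
  by rewrite gt_eqF// mulr_gt0.
case/andP: (@pihalf_02 R) => p0 p2; rewrite mulrA normrM (gtr0_norm p0).
have := ler_dist_dist s t; rewrite (distrC `|s|) => h.
by apply: ler_pM => //; exact: ltW.
Qed.

(** Since [2 * t * rho t] is [pi - 2 * rho t] or its opposite, according to the sign of [t], the
    phase moves by [pi] or [- pi] up to [4 * rho t]; the two rotations are then nearly opposite. *)
Lemma frakg_rho_cancel t v w :
  `|frakg t *: v + frakg (t + rho t) *: w| <= 2 * `|w - v| + 8 * rho t * `|v|.
Proof.
have r0 := rho_gt0 t; have r2 := rho_le2 t.
have -> : frakg t *: v + frakg (t + rho t) *: w =
    frakg (t + rho t) *: (w - v) + (frakg (t + rho t) *: v + frakg t *: v).
  by rewrite scalerBr addrA subrK addrC.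
apply: le_trans (ler_normD _ _) _; apply: lerD; first exact: norm_expi_le.
have rE : rho t * (1 + `|t|) = pi / 2.
  by rewrite /rho -mulrA mulVf ?mulr1// gt_eqF// ltr_pwDl.
have key (p : R) : expi p = -1 -> `|(t + rho t) ^+ 2 - (t ^+ 2 + p)| <= 4 * rho t ->
    `|frakg (t + rho t) *: v + frakg t *: v| <= 8 * rho t * `|v|.
  move=> ep hp; have -> : frakg t *: v = - (expi (t ^+ 2 + p) *: v).
    by rewrite expiD ep mulrN1 scaleNr opprK.
  apply: le_trans (norm_expiB_le _ _ _) _; rewrite ler_wpM2r//; lra.
have bound x : `|x| <= 2 * rho t -> `|rho t ^+ 2 + x| <= 4 * rho t.
  rewrite !ler_norml => /andP[x1 x2]; apply/andP; split; first nra.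
  have : rho t ^+ 2 <= 2 * rho t by rewrite expr2; apply: ler_wpM2r => //; exact: ltW.
  by move=> ?; lra.
have [t0|t0] := leP 0 t.
  apply: (key pi); first exact: expi_pi.
  rewrite ger0_norm// in rE.
  have -> : (t + rho t) ^+ 2 - (t ^+ 2 + pi) = rho t ^+ 2 + (- (2 * rho t)).
    have -> : pi = 2 * (rho t * (1 + t)) :> R by rewrite rE; field.
    by ring.
  by apply: bound; rewrite normrN ger0_norm//; lra.
apply: (key (- pi)); first by rewrite expiN expi_pi invrN invr1.
rewrite ltr0_norm// in rE.
have -> : (t + rho t) ^+ 2 - (t ^+ 2 - pi) = rho t ^+ 2 + 2 * rho t.
  have -> : pi = 2 * (rho t * (1 - t)) :> R by rewrite rE; field.
  by ring.
by apply: bound; rewrite ger0_norm//; lra.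
Qed.

End PhaseShift.

(** * Rotated increments: cocycle relation and boundedness *)

Section Core.
Variables (R : realType) (X : normedModType R) (J : set R).
Local Notation E := (complexification X).
Hypothesis J_up : forall t s : R, J t -> 0 <= s -> J (t + s).

(** Cut the shift into [n] steps shorter than the modulus for 1; each moves [f] by at most 1. *)
Lemma UC_shift_bounded (f : R -> E) d : UC X J f -> 0 <= d ->
  exists C, forall t, J t -> `|f (t + d) - f t| <= C.
Proof.
move=> /UCP ucf d0; have [e e0 K] := ucf 1 ltr01.
pose n := (Num.truncn (d / e)).+1.
have n0 : 0 < n%:R :> R by rewrite ltr0n.
have dn : d / n%:R < e by rewrite ltr_pdivrMr// mulrC -ltr_pdivrMr// truncnS_gt.
exists n%:R => t Jt.
suff H k : `|f (t + d / n%:R * k%:R) - f t| <= k%:R.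
  by have := H n; rewrite divfK// gt_eqF.
have dk i : 0 <= d / n%:R * i%:R by rewrite mulr_ge0// divr_ge0//.
elim: k => [|k IH]; first by rewrite mulr0 addr0 subrr normr0.
rewrite (le_trans (ler_distD (f (t + d / n%:R * k%:R)) _ _))//.
rewrite -[leRHS]natr1 addrC; apply: lerD => //; apply/ltW/K; [exact: J_up..|].
rewrite [X in `|X|](_ : _ = d / n%:R); last by rewrite -natr1; ring.
by rewrite ger0_norm// divr_ge0.
Qed.

Variable psi : R -> E.

Definition rot_Delta (s t : R) : E := (frakg t)^-1 *: Delta s psi t.
Local Notation h := rot_Delta.

Lemma frakg_rot_Delta s t : frakg t *: h s t = psi (t + s) - psi t.
Proof. by rewrite /h scalerA mulfV ?scale1r// expi_neq0. Qed.

(** The increment by [s + r] splits at [t + s]; the rotation is the quotient of [frakg] at [t + s]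
    and at [t]. *)
Lemma rot_Delta_cocycle s r t :
  h (s + r) t = expi (s ^+ 2 + 2 * s * t) *: h r (t + s) + h s t.
Proof.
have -> : expi (s ^+ 2 + 2 * s * t) = (frakg t)^-1 * frakg (t + s).
  by rewrite frakgV -expiD; congr expi; ring.
rewrite -scalerA frakg_rot_Delta /h -scalerDr /Delta.
by rewrite subrKA addrA.
Qed.

Hypothesis hUC : forall s : R, 0 < s -> UC X J (h s).

(* [h r (t + 1)] rotated by [expi (1 + 2 t)] is a difference of uniformly
   continuous functions; a shift by [pi / 2] flips the sign of the rotation. *)
Lemma rot_Delta_bounded s : 0 < s -> exists N, forall t, J t -> `|h s t| <= N.
Proof.
move=> s0; have p0 : 0 <= pi / 2 :> R by rewrite divr_ge0// pi_ge0.
have s10 : 0 < 1 + s by rewrite addr_gt0.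
have [C1 H1] := UC_shift_bounded (hUC s10) p0.
have [C2 H2] := UC_shift_bounded (hUC ltr01) p0.
have [C3 H3] := UC_shift_bounded (hUC s0) p0.
have [C4 H4] := UC_shift_bounded (hUC s0) ler01.
exists (2 * (C1 + C2) + C3 + C4) => t Jt.
have Jt1 : J (t + 1) by exact: J_up.
set a := h s (t + 1); set b := h s (t + pi / 2 + 1).
have e1 : h (1 + s) (t + pi / 2) - h (1 + s) t - (h 1 (t + pi / 2) - h 1 t) =
    - (expi (1 + 2 * t) *: (a + b)).
  rewrite !rot_Delta_cocycle -/a -/b expr1n mulr1.
  have -> : 1 + 2 * (t + pi / 2) = 1 + 2 * t + pi by field.
  rewrite expiD expi_pi mulrN1 scaleNr scalerDr.
  set A := expi _ *: a; set B := expi _ *: b; rewrite opprB.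
  have -> : - B + h 1 (t + pi / 2) - (A + h 1 t) =
      - (A + B) + (h 1 (t + pi / 2) - h 1 t) by rewrite !opprD addrACA (addrC (- A)).
  by rewrite -addrA subrKA subrr addr0.
have ab : `|a + b| <= 2 * (C1 + C2).
  rewrite (le_trans (norm_le_expi (1 + 2 * t) _))// ler_pM2l//.
  rewrite -normrN -e1 (le_trans (ler_normB _ _))// lerD//; [exact: H1|exact: H2].
have ba : `|b - a| <= C3 by rewrite /b /a addrAC; exact: H3.
have ha : `|h s t| <= C4 + `|a|.
  by rewrite -[h s t](subKr a) (le_trans (ler_normB _ _))// addrC lerD//; exact: H4.
have aa : `|a| *+ 2 <= 2 * (C1 + C2) + C3.
  rewrite -normrMn mulr2n; have -> : a + a = (a + b) - (b - a).
    by rewrite opprB addrACA subrr addr0.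
  by rewrite (le_trans (ler_normB _ _))// lerD.
have := normr_ge0 a; move: aa; rewrite mulr2n; lra.
Qed.

End Core.

Lemma rho_small (R : realType) (d : R) : 0 < d ->
  exists M, forall t, M <= `|t| -> rho t < d.
Proof.
move=> d0; exists (2 / d) => t; rewrite ler_pdivrMr// => Mt.
rewrite ltNge; apply/negP => dr; have := rho_le t; have := normr_ge0 t; nra.
Qed.

Lemma closed_norm_le (R : realType) (X : normedModType R)
    (F : R -> complexification X) (c : R) :
  continuous F -> closed [set s | `|F s| <= c].
Proof.
move=> cF; apply: (@closed_comp _ _ (fun s => `|F s|) [set x | x <= c]).
  by move=> s _; apply: continuous_comp (cF s) (@norm_continuous _ _ _).
exact: closed_le.
Qed.

(** * Automatic continuity of [psi] *)

Section Continuity.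
Variables (R : realType) (X : normedModType R) (J : set R) (pr : R -> R).
Local Notation E := (complexification X).
Hypothesis J_up : forall t s : R, J t -> 0 <= s -> J (t + s).
Hypothesis J0 : J 0.
Hypothesis pr_cont : continuous pr.
Hypothesis prJ : forall t, J (pr t).
Hypothesis pr_id : forall t, J t -> pr t = t.

(** [pr] is a continuous retraction of the line onto [J]; composing with it extends continuity on
    [J] to the whole line. *)
Lemma continuous_pr (f : R -> E) :
  {within J, continuous f} -> continuous (f \o pr).
Proof.
move=> /within_continuousP cf; apply/continuousP_dist => x e e0.
have [d d0 K] := cf (pr x) e (prJ x) e0.
have /cvgrPdist_lt/(_ d d0)/nbhs_ballP[r r0 L] := @pr_cont x.
exists r => // y xy; apply: K => //.
by apply: L; rewrite -ball_normE.
Qed.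

Lemma UC_within_continuous (f : R -> E) : UC X J f -> {within J, continuous f}.
Proof.
move=> /UCP ucf; apply/within_continuousP => x e Jx e0.
by have [d d0 K] := ucf e e0; exists d => // y; exact: K.
Qed.

Variable psi : R -> E.
Hypothesis psi_pr : forall t, psi (pr t) = psi t.
Local Notation h := (rot_Delta psi).
Hypothesis hUC : forall s : R, 0 < s -> UC X J (h s).

(** Increments are continuous before [psi] is known to be: on [J] each is [frakg] times the
    uniformly continuous [h s]. *)
Lemma Delta_pr_continuous s : 0 <= s -> continuous (fun t => Delta s psi (pr t)).
Proof.
rewrite le_eqVlt => /orP[/eqP <-|s0].
  rewrite (_ : (fun _ => _) = fun=> 0); first by move=> ?; exact: cvg_cst.
  by apply/funext => t; rewrite /Delta addr0 subrr.
rewrite (_ : (fun _ => _) = fun t => expi (pr t ^+ 2) *: (h s \o pr) t).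
  apply: continuous_expi_scale => [t|]; last exact/continuous_pr/UC_within_continuous/hUC.
  by apply: continuous_comp (@pr_cont t) (@exprn_continuous _ 2 _).
by apply/funext => t; rewrite [RHS]frakg_rot_Delta.
Qed.

Let lo (n : nat) : R := n.+1%:R.
Let hi (n : nat) : R := lo n + rho (lo n).

Let hi_ge0 n : 0 <= hi n. Proof. by rewrite addr_ge0// ltW// rho_gt0. Qed.

(** The base point varies and the steps are fixed, which makes [c n] continuous; regrouping
    [c n s - c n 0] with twice [psi s - psi 0] gives increments by [s] at [lo n] and [hi n]. *)
Let c (n : nat) (s : R) : E := Delta (lo n) psi (pr s) + Delta (hi n) psi (pr s).

Let c_continuous n : continuous (c n).
Proof.
move=> s; apply: cvgD; exact: Delta_pr_continuous.
Qed.

(* [psi] is, up to constants, a pointwise limit of continuous functions: the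
   two increments by [s] at the points [lo n] and [hi n] asymptotically cancel. *)
Let psi_limit s e : 0 < s -> 0 < e -> exists N, forall n, (N <= n)%N ->
  `|c n s - c n 0 + (psi s - psi 0) *+ 2| <= e.
Proof.
move=> s0 e0; have Js : J s by rewrite -[s]add0r; apply: J_up => //; exact: ltW.
have Jlo n : J (lo n) by rewrite -[lo n]add0r; exact: J_up.
have [N HN] := rot_Delta_bounded J_up hUC s0.
have N0 : 0 <= N by exact: le_trans (HN _ J0).
have e4 : 0 < e / 4 by rewrite divr_gt0.
have [d d0 K] := (UCP J (h s)).1 (hUC s0) (e / 4) e4.
(* The second bound keeps [8 * rho (lo n) * N] below [e / 2]; [N + 1] avoids a zero denominator. *)
have d'0 : 0 < Num.min d (e / (16 * (N + 1))).
  by rewrite lt_min d0 divr_gt0// mulr_gt0// ltr_pwDr.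
have [M HM] := rho_small d'0.
exists (Num.truncn `|M|) => n Nn.
have : rho (lo n) < Num.min d (e / (16 * (N + 1))).
  apply: HM; rewrite ger0_norm//; apply: le_trans (ler_norm _) _.
  by apply/ltW/(lt_le_trans (truncnS_gt _)); rewrite ler_nat ltnS.
rewrite lt_min => /andP[rd re].
have -> : c n s - c n 0 + (psi s - psi 0) *+ 2 =
    frakg (lo n) *: h s (lo n) + frakg (lo n + rho (lo n)) *: h s (lo n + rho (lo n)).
  rewrite !frakg_rot_Delta -/(hi n) /c !pr_id// /Delta !add0r.
  rewrite (addrC (lo n)) (addrC (hi n)) mulr2n.
  set A := psi (s + lo n); set B := psi (s + hi n); set P := psi s.
  rewrite [in LHS](opprD (_ - _)) (addrACA (A - P)) [LHS]addrACA.
  by congr (_ + _); rewrite addrAC subrKA opprB subrKA.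
apply: le_trans (frakg_rho_cancel _ _ _) _.
have Jhi : J (lo n + rho (lo n)) by apply: J_up => //; rewrite ltW// rho_gt0.
have h1 : `|h s (lo n + rho (lo n)) - h s (lo n)| < e / 4.
  by apply: K => //; rewrite addrAC subrr add0r gtr0_norm// rho_gt0.
have h2 : 8 * rho (lo n) * `|h s (lo n)| <= e / 2.
  have := HN _ (Jlo n); move: re; rewrite ltr_pdivlMr ?mulr_gt0 ?ltr_pwDr//.
  have := normr_ge0 (h s (lo n)); have := rho_gt0 (lo n).
  by move: `|h s (lo n)| (rho (lo n)) => a r r0 a0 re aN; nra.
lra.
Qed.

(** By Baire, some term of a pointwise convergent sequence of continuous functions is uniformly
    close to the limit on a segment; near its midpoint the limit then oscillates little. The
    condition [d < m] keeps the neighbourhood in the positive reals, hence in [J]. *)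
Let psi_small_oscillation (e : R) : 0 < e -> exists m d, [/\ 0 < d, d < m &
  forall s, `|s - m| < d -> `|psi s - psi m| <= 3 * e].
Proof.
move=> e0; pose P s := (psi s - psi 0) *+ 2.
pose A N := [set s | forall n, (N <= n)%N -> `|(c N s - c N 0) - (c n s - c n 0)| <= e].
have e20 : 0 < e / 2 by rewrite divr_gt0.
have Fc n : continuous (fun s => c n s - c n 0).
  by move=> s; apply: cvgB; [exact: c_continuous|exact: cvg_cst].
have clA N : closed (A N).
  rewrite (_ : A N = \bigcap_(n in [set n | (N <= n)%N])
    [set s | `|(c N s - c N 0) - (c n s - c n 0)| <= e]).
    apply: closed_bigI => n _; apply: closed_norm_le => s.
    by apply: cvgB; exact: Fc.
  by apply/seteqP; split => s H n; exact: H.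
have [||N [a [b [a1 ab b2 abA]]]] := closed_cover_itv (a := 1) (b := 2) _ clA.
- by rewrite ltr1n.
- move=> s; rewrite /= in_itv/= => /andP[s1 s2].
  have [|N HN] := psi_limit (s := s) _ e20; first lra.
  exists N => // n Nn; rewrite -(addrKA (P s)) (addrC (P s)).
  by rewrite (le_trans (ler_normB _ _))// (splitr e) lerD//; exact: HN.
(* Comparison with a late term: [e] from [A N] and [e] from the limit. *)
have close s : a <= s -> s <= b -> `|c N s - c N 0 + P s| <= 2 * e.
  move=> sa sb; have [|M HM] := psi_limit (s := s) _ e0; first lra.
  have sA : A N s by apply: abA; rewrite /= in_itv/= sa sb.
  have := HM (maxn N M) (leq_maxr _ _); have := sA _ (leq_maxl N M).
  set u := c N s - _; set v := c _ s - _ => uv vP.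
  have -> : u + P s = (u - v) + (v + P s) by rewrite subrKA.
  by rewrite (le_trans (ler_normD _ _))//; lra.
pose m := (a + b) / 2.
have [d d0 K] := (continuousP_dist _).1 (Fc N) m e e0.
exists m, (Num.min d ((b - a) / 2)); split.
- by rewrite lt_min d0/= divr_gt0// subr_gt0.
- by rewrite gt_min; apply/orP; right; rewrite /m; lra.
move=> s; rewrite lt_min => /andP[sd]; rewrite ltr_norml => /andP[s1 s2].
have hs : `|c N s - c N 0 + P s| <= 2 * e by apply: close; rewrite /m in s1 s2; lra.
have hm : `|c N m - c N 0 + P m| <= 2 * e by apply: close; rewrite /m; lra.
have hc := K s; rewrite distrC in hc; have {}hc := hc sd.
have : `|(psi s - psi m) *+ 2| <= 5 * e.
  have -> : (psi s - psi m) *+ 2 = (c N s - c N 0 + P s) - (c N m - c N 0 + P m)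
     + ((c N m - c N 0) - (c N s - c N 0)).
    set u := c N s - _; set v := c N m - _.
    by rewrite opprD (addrACA u) [RHS]addrAC subrKA subrr add0r -mulrnBl opprB subrKA.
  rewrite (le_trans (ler_normD _ _))//.
  have := ler_normB (c N s - c N 0 + P s) (c N m - c N 0 + P m); lra.
rewrite normrMn mulr2n; lra.
Qed.

(** The increment between [t] and [m] depends continuously on its base point, so small oscillation
    at [m] is carried to [t]. *)
Lemma psi_continuous : continuous psi.
Proof.
rewrite (_ : psi = psi \o pr); last by apply/funext => t /=; rewrite psi_pr.
apply/continuous_pr/within_continuousP => t e Jt e0.
have e8 : 0 < e / 8 by rewrite divr_gt0.
have e2 : 0 < e / 2 by rewrite divr_gt0.
have [m [d [d0 dm H]]] := psi_small_oscillation e8.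
have Jge s : 0 <= s -> J s by move=> s0; rewrite -[s]add0r; exact: J_up.
have [tm|mt] := leP t m.
  have r0 : 0 <= m - t by rewrite subr_ge0.
  have [d' d'0 K] := (continuousP_dist _).1 (Delta_pr_continuous r0) t _ e2.
  exists (Num.min d d'); first by rewrite lt_min d0.
  move=> t' Jt'; rewrite lt_min => /andP[td td'].
  have := K t' td'; rewrite /= !pr_id// /Delta (addrC t) subrK => h1.
  have h2 : `|psi (t' + (m - t)) - psi m| <= 3 * (e / 8).
    by apply: H; rewrite addrA addrAC addrK distrC.
  have -> : psi t - psi t' = (psi m - psi (t' + (m - t)))
     - (psi m - psi t - (psi (t' + (m - t)) - psi t')).
    by rewrite opprB addrA subrKA opprB addrC subrKA.
  by rewrite (le_lt_trans (ler_normB _ _))// distrC; lra.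
(* Now the base point is near [m]: [d < m] makes [t' - (t - m)] positive, hence in [J]. *)
have r0 : 0 <= t - m by rewrite subr_ge0 ltW.
have [d' d'0 K] := (continuousP_dist _).1 (Delta_pr_continuous r0) m _ e2.
exists (Num.min d d'); first by rewrite lt_min d0.
move=> t' Jt'; rewrite lt_min => /andP[td td'].
have E1 : m - (t' - (t - m)) = t - t' by ring.
have Js : J (t' - (t - m)).
  by apply: Jge; move: td; rewrite ltr_norml => /andP[]; lra.
have := K (t' - (t - m)); rewrite E1 => /(_ td').
rewrite /= !pr_id//; last by apply: Jge; lra.
rewrite /Delta subrK (addrC m) subrK => h1.
have h2 : `|psi (t' - (t - m)) - psi m| <= 3 * (e / 8).
  by apply: H; rewrite distrC E1.
have -> : psi t - psi t' = (psi t - psi m - (psi t' - psi (t' - (t - m))))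
     - (psi (t' - (t - m)) - psi m).
  by rewrite !opprB addrAC !subrKA.
by rewrite (le_lt_trans (ler_normB _ _))//; lra.
Qed.

End Continuity.

(** * Equicontinuity of the increments and slow variation of [psi] *)

Section Equicontinuity.
Variables (R : realType) (X : normedModType R) (J : set R).
Local Notation E := (complexification X).
Hypothesis J_up : forall t s : R, J t -> 0 <= s -> J (t + s).
Hypothesis J0 : J 0.
Variable psi : R -> E.
Hypothesis psi_cont : continuous psi.
Local Notation h := (rot_Delta psi).
Hypothesis hUC : forall s : R, 0 < s -> UC X J (h s).

Lemma rot_Delta_continuous t : continuous (h ^~ t).
Proof.
rewrite (_ : h ^~ t = fun s => expi (- t ^+ 2) *: Delta s psi t); last first.
  by apply/funext => s; rewrite /rot_Delta frakgV.
apply: continuous_expi_scale => [s|s]; first exact: cvg_cst.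
apply: cvgB; last exact: cvg_cst.
apply: (@continuous_comp _ _ _ (fun s => t + s)); last exact: psi_cont.
by apply: cvgD; [exact: cvg_cst|exact: cvg_id].
Qed.

(** Baire yields a common bound for all steps in some [[c, d]]; a step [s <= 2] is the difference of
    a step [s + p] in that segment and one of finitely many steps [p]. *)
Lemma rot_Delta_equicontinuous (e : R) : 0 < e ->
  exists N d : R, 0 < d /\ forall s t, 0 < s -> s <= 2 -> J t ->
    `|h s t| <= N /\ forall t', J t' -> `|t - t'| < d -> `|h s t - h s t'| <= e.
Proof.
move=> e0; have e40 : 0 < e / 4 by rewrite divr_gt0.
(* Non-strict bounds on [h] make [P n] closed in [s]. *)
pose P (n : nat) s := forall t, J t -> `|h s t| <= n%:R /\
  forall t', J t' -> `|t - t'| <= n.+1%:R^-1 -> `|h s t - h s t'| <= e / 4.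
have Pmono n m s : (n <= m)%N -> P n s -> P m s.
  move=> nm Pn t Jt; have [Pt Pt'] := Pn t Jt; split.
    by rewrite (le_trans Pt)// ler_nat.
  move=> t' Jt' tt'; apply: Pt' => //; rewrite (le_trans tt')//.
  by rewrite lef_pV2 ?posrE// ler_nat.
have Pex s : 0 < s -> exists n, P n s.
  move=> s0; have [N HN] := rot_Delta_bounded J_up hUC s0.
  have [d d0 K] := (UCP J (h s)).1 (hUC s0) _ e40.
  exists ((Num.truncn `|N|).+1 + Num.truncn d^-1)%N => t Jt; split.
    rewrite (le_trans (HN _ Jt))// (le_trans (ler_norm _))//.
    by rewrite (le_trans (ltW (truncnS_gt _)))// ler_nat leq_addr.
  move=> t' Jt' tt'; apply/ltW/K => //; rewrite (le_lt_trans tt')//.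
  rewrite invf_plt ?posrE// (lt_le_trans (truncnS_gt _))// ler_nat ltnS.
  exact: leq_addl.
have clP n : closed [set s | P n s].
  rewrite (_ : [set s | P n s] = \bigcap_(t in J) ([set s | `|h s t| <= n%:R] `&`
    \bigcap_(t' in [set t' | J t' /\ `|t - t'| <= n.+1%:R^-1])
      [set s | `|h s t - h s t'| <= e / 4])).
    apply: closed_bigI => t _; apply: closedI.
      by apply: closed_norm_le; exact: rot_Delta_continuous.
    apply: closed_bigI => t' _; apply: closed_norm_le => s.
    by apply: cvgB; exact: rot_Delta_continuous.
  apply/seteqP; split => s H t Jt.
    have [H1 H2] := H t Jt; split=> // t' [Jt' tt']; exact: H2.
  have [H1 H2] := H t Jt; split=> // t' Jt' tt'; exact: (H2 t').
(* The interval lies above 2 so that [c - s] stays positive for all [s <= 2]. *)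
have [||n [c [d [c3 cd d4 cdP]]]] := closed_cover_itv (a := 3) (b := 4) _ clP.
- lra.
- move=> s; rewrite /= in_itv/= => /andP[s3 s4].
  by have [|n Pn] := Pex s; [lra|exists n].
pose w := d - c; have w0 : 0 < w by rewrite subr_gt0.
have [m Hm] : exists m : nat -> nat, forall k, 0 < c - k%:R * w -> P (m k) (c - k%:R * w).
  suff /choice[m Hm] : forall k : nat, exists m, 0 < c - k%:R * w -> P m (c - k%:R * w).
    by exists m.
  move=> k.
  have [p0|p0] := ltP 0 (c - k%:R * w); last by exists 0%N.
  by have [m Pm] := Pex _ p0; exists m.
pose K := Num.truncn (2 / w).
pose M := (n + \max_(k < K.+1) m k)%N.
have M0 : 0 < M%:R + 1 :> R by rewrite ltr_pwDr.
(* With [k * w <= s < (k + 1) * w] and [p = c - k * w], the sum [s + p] falls into [[c, d]], whose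
   length is [w]. *)
have split_s s : 0 < s -> s <= 2 -> exists p, P M p /\ P M (s + p).
  move=> s0 s2; pose k := Num.truncn (s / w).
  have kw : k%:R * w <= s by rewrite -ler_pdivlMr// truncn_le// divr_ge0 ?ltW.
  have sk : s < (k%:R + 1) * w by rewrite -ltr_pdivrMr// natr1 truncnS_gt.
  have kK : (k < K.+1)%N by rewrite ltnS le_truncn// ler_pM2r ?invr_gt0.
  exists (c - k%:R * w); split.
    apply: (Pmono (m k)); last by apply: Hm; lra.
    by rewrite (leq_trans _ (leq_addl _ _))// (leq_bigmax (Ordinal kK)).
  apply: (Pmono n); first exact: leq_addr.
  have dE : d = c + w by rewrite /w addrC subrK.
  apply: cdP; rewrite /= in_itv/= dE; move: kw sk; rewrite mulrDl mul1r.
  by move: (k%:R * w) => q kw sk; apply/andP; split; lra.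
(* [h s] costs one [h (s + p)] and a rotated, hence doubled, [h p]; the last bound makes the drift
   of the rotation at most [e / 4]. *)
exists (3 * M%:R), (Num.min (M.+1%:R^-1) (e / (32 * (M%:R + 1)))); split.
  by rewrite lt_min invr_gt0 ltr0n/= divr_gt0// mulr_gt0.
move=> s t s0 s2 Jt; have [p [Pp Psp]] := split_s s s0 s2.
have Jts x : J x -> J (x + s) by move=> Jx; apply: J_up => //; exact: ltW.
have hE x : h s x = h (s + p) x - expi (s ^+ 2 + 2 * s * x) *: h p (x + s).
  by rewrite rot_Delta_cocycle addrC addKr.
split.
  rewrite hE (le_trans (ler_normB _ _))//.
  have := norm_expi_le (s ^+ 2 + 2 * s * t) (h p (t + s)).
  have := (Psp _ Jt).1; have := (Pp _ (Jts _ Jt)).1; lra.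
move=> t' Jt'; rewrite lt_min => /andP[t1 t2].
rewrite !hE; set B := expi _ *: _; set D := expi _ *: _.
rewrite opprD opprK addrACA (addrC (- B)) -(opprB B).
rewrite (le_trans (ler_normB _ _))//.
have h1 := (Psp _ Jt).2 _ Jt' (ltW t1).
have := (Pp _ (Jts _ Jt)).2 _ (Jts _ Jt').
rewrite opprD addrACA subrr addr0 => /(_ (ltW t1)) h2.
have := norm_expi_dist_le (s ^+ 2 + 2 * s * t) (s ^+ 2 + 2 * s * t')
  (h p (t + s)) (h p (t' + s)).
rewrite opprD addrACA subrr add0r -mulrBr normrM (gtr0_norm (mulr_gt0 _ s0))//.
have h3 := (Pp _ (Jts _ Jt')).1.
move: t2; rewrite ltr_pdivlMr ?mulr_gt0// => t2.
have h4 : 2 * (2 * s * `|t - t'|) * `|h p (t' + s)| <= e / 4.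
  have a0 := normr_ge0 (t - t'); have b0 := normr_ge0 (h p (t' + s)).
  apply: (@le_trans _ _ (2 * (2 * 2 * `|t - t'|) * (M%:R + 1))); last lra.
  have s00 := ltW s0.
  apply: ler_pM; [by rewrite !mulr_ge0|by []| |lra].
  by rewrite ler_pM2l// ler_wpM2r// ler_pM2l.
by move=> h5; lra.
Qed.

(** For large [t], the increments by [tau] at [t] and at [t + rho t] nearly cancel and also nearly
    agree, so each is small. For bounded [t], [psi] is uniformly continuous on a segment. *)
Lemma psi_increment_small (e : R) : 0 < e -> exists2 eta : R, 0 < eta &
  forall t tau, J t -> 0 < tau -> tau * (1 + `|t|) <= eta ->
    `|psi (t + tau) - psi t| <= e.
Proof.
move=> e0; have e80 : 0 < e / 8 by rewrite divr_gt0.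
have [N [d [d0 HN]]] := rot_Delta_equicontinuous e80.
have N0 : 0 <= N by apply: le_trans (HN 1 0 ltr01 _ J0).1 => //; rewrite ler1n.
have N1 : 0 < N + 1 by rewrite ltr_pwDr.
have d'0 : 0 < Num.min d (e / (32 * (N + 1))).
  by rewrite lt_min d0 divr_gt0// mulr_gt0.
have [M HM] := rho_small d'0.
have [d2 d20 K2] := continuous_unif_on_segment M psi_cont e0.
exists (Num.min (Num.min 1 (d / 2)) (Num.min (e / (16 * (N + 1))) (d2 / 2))).
  by rewrite !lt_min ltr01 !divr_gt0// mulr_gt0.
move=> t tau Jt tau0; rewrite !le_min => /andP[/andP[p1 p2] /andP[p3 p4]].
have a0 := normr_ge0 t.
have tau_le : tau <= tau * (1 + `|t|) by rewrite -[leLHS]mulr1 ler_pM2l// lerDl.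
have [Mt|tM] := leP M `|t|; last first.
  rewrite distrC ltW// K2// ?ltW//.
  by rewrite opprD addrA subrr sub0r normrN gtr0_norm//; lra.
have := HM _ Mt; rewrite lt_min => /andP[rd re].
set r := rho t in rd re *.
have r0 : 0 < r by exact: rho_gt0.
have Jtr : J (t + r) by apply: J_up => //; exact: ltW.
have Jtt : J (t + tau) by apply: J_up => //; exact: ltW.
have tau2 : tau <= 2 by lra.
set v := psi (t + tau) - psi t.
have S : `|v + frakg (t + r) *: h tau (t + r)| <= 2 * (e / 8) + 8 * r * N.
  rewrite /v -frakg_rot_Delta (le_trans (frakg_rho_cancel _ _ _))//.
  apply: lerD.
    rewrite ler_pM2l//; apply: (HN tau (t + r) tau0 tau2 Jtr).2 => //.
    by rewrite addrAC subrr add0r gtr0_norm.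
  apply: ler_wpM2l; first by rewrite mulr_ge0// ltW.
  exact: (HN tau t tau0 tau2 Jt).1.
(* The mixed second difference is symmetric in [r] and [tau], and between [t] and [t + tau] the
   phase of [frakg] hardly moves. *)
have D : `|frakg (t + r) *: h tau (t + r) - v| <=
    2 * (e / 8) + 4 * (tau * (1 + `|t|)) * N.
  have -> : frakg (t + r) *: h tau (t + r) - v =
      frakg (t + tau) *: h r (t + tau) - frakg t *: h r t.
    rewrite !frakg_rot_Delta /v (addrAC t r) !opprB addrACA [RHS]addrACA.
    by congr (_ + _); rewrite addrC.
  apply: le_trans (norm_expi_dist_le _ _ _ _) _; apply: lerD.
    rewrite ler_pM2l//; apply: (HN r (t + tau) r0 (rho_le2 t) Jtt).2 => //.
    rewrite addrAC subrr add0r gtr0_norm//; lra.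
  apply: ler_pM => //; last exact: (HN r t r0 (rho_le2 t) Jt).1.
  have -> : (t + tau) ^+ 2 - t ^+ 2 = tau * (tau + 2 * t) by ring.
  rewrite normrM (gtr0_norm tau0).
  rewrite (_ : 4 * _ = 2 * (tau * (2 * (1 + `|t|)))); last by ring.
  rewrite ler_pM2l// ler_pM2l// (le_trans (ler_normD _ _))// normrM.
  rewrite (gtr0_norm tau0) gtr0_norm//.
  lra.
have : `|v| *+ 2 <= 2 * (e / 8) + 8 * r * N + (2 * (e / 8) + 4 * (tau * (1 + `|t|)) * N).
  rewrite -normrMn mulr2n.
  have -> : v + v = (v + frakg (t + r) *: h tau (t + r)) -
      (frakg (t + r) *: h tau (t + r) - v).
    by rewrite opprB [RHS]addrACA subrr addr0.
  by rewrite (le_trans (ler_normB _ _))// lerD.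
move: p3 re; rewrite ler_pdivlMr ?mulr_gt0// ltr_pdivlMr ?mulr_gt0//.
rewrite mulr2n; move: (tau * _) => x p3 re; nra.
Qed.

Lemma psi_slowly_varying (e : R) : 0 < e -> exists2 eta : R, 0 < eta &
  forall x y, J x -> J y -> `|x - y| * (1 + `|x|) <= eta -> `|psi x - psi y| <= e.
Proof.
move=> e0; have [eta eta0 H] := psi_increment_small e0.
(* When [y < x] the base point becomes [y]; as [x - y <= 1], [1 + |y|] is at most [2 * (1 + |x|)],
   whence [eta / 2]. *)
exists (Num.min 1 (eta / 2)); first by rewrite lt_min ltr01 divr_gt0.
move=> x y Jx Jy; rewrite le_min => /andP[h1 h2].
have a0 := normr_ge0 x.
have [xy|yx|<-] := ltgtP x y; last by rewrite subrr normr0 ltW.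
  rewrite distrC -[y in psi y](addrNK x) (addrC (y - x)).
  apply: H => //; first by rewrite subr_gt0.
  by move: h2; rewrite distrC gtr0_norm ?subr_gt0//; lra.
rewrite -[x in psi x](addrNK y) (addrC (x - y)).
apply: H => //; first by rewrite subr_gt0.
move: h1 h2; rewrite gtr0_norm ?subr_gt0// => h1 h2.
have : `|y| <= `|x| + (x - y).
  by rewrite -[x - y]gtr0_norm ?subr_gt0// -[in `|y|](subKr x y) ler_normB.
have : 0 < x - y by rewrite subr_gt0.
move: (x - y) `|x| `|y| a0 h1 h2 => d a b a0 h1 h2 d0 b1; nra.
Qed.

End Equicontinuity.

(** * Decomposition into a bounded part and a slowly varying part *)

Section Half.
Variables (R : realType) (X : normedModType R).
Local Notation E := (complexification X).
Implicit Types v w : E.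

Definition half : R[i] := (2^-1)%:C%C.

Lemma half_double v : half *: (v + v) = v.
Proof.
rewrite scalerDr -scalerDl -[RHS]scale1r; congr (_ *: _).
have h : 2^-1 + 2^-1 = 1 :> R by lra.
by apply/eqP; rewrite eq_complex /= addr0 h !eqxx.
Qed.

Lemma norm_half_le v : `|half *: v| <= `|v|.
Proof.
apply: le_trans (norm_scale_le _ _) _ => /=.
rewrite normr0 addr0 gtr0_norm// ler_piMl// invf_le1// ler1n//.
Qed.

End Half.

Lemma rho_continuous (R : realType) : continuous (@rho R).
Proof.
move=> t; apply: cvgM; first exact: cvg_cst.
apply: cvgV; first by rewrite gt_eqF// ltr_pwDl.
by apply: cvgD; [exact: cvg_cst|exact: norm_continuous].
Qed.

Section Decomposition.
Variables (R : realType) (X : normedModType R) (J : set R) (pr : R -> R).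
Local Notation E := (complexification X).
Hypothesis J_up : forall t s : R, J t -> 0 <= s -> J (t + s).
Hypothesis J0 : J 0.
Hypothesis pr_cont : continuous pr.
Hypothesis prJ : forall t, J (pr t).
Hypothesis pr_id : forall t, J t -> pr t = t.

Lemma eq_on_UC (f f' : R -> E) :
  (forall t, J t -> f t = f' t) -> UC X J f -> UC X J f'.
Proof.
move=> ff' /UCP uf; apply/UCP => e /uf[d d0 K]; exists d => // x y Jx Jy.
by rewrite -!ff'//; exact: K.
Qed.

Variable psi : R -> E.
Hypothesis psi_pr : forall t, psi (pr t) = psi t.
Local Notation h := (rot_Delta psi).
Hypothesis hUC : forall s : R, 0 < s -> UC X J (h s).

Let psi_cont : continuous psi := psi_continuous J_up J0 pr_cont prJ pr_id psi_pr hUC.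

Definition bounded_part (t : R) : E := - (half R *: h (rho t) t).

(** [pr] makes this continuous on the whole line, from which local integrability follows. *)
Definition slow_part (t : R) : E := half R *: (psi t + psi (pr t + rho (pr t))).

Lemma bounded_slow_partE t : J t ->
  (frakg t)^-1 *: psi t = bounded_part t + (frakg t)^-1 *: slow_part t.
Proof.
move=> Jt; rewrite /bounded_part /slow_part /rot_Delta /Delta pr_id//.
rewrite (scalerA (half R)) (mulrC (half R)) -scalerA [RHS]addrC -!scalerBr opprB.
by rewrite (addrACA (psi t)) subrr addr0 half_double.
Qed.

Let J_rho t : J t -> J (t + rho t).
Proof. by move=> Jt; apply: J_up => //; exact/ltW/rho_gt0. Qed.

(** All steps [rho t] lie in []0, 2]], where [h] is equibounded and equicontinuous; replacing
    [rho t] by [rho t'] costs an increment of [psi] that slow variation controls. *)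
Lemma bounded_part_BUC : BUC X J bounded_part.
Proof.
have dist t t' : `|bounded_part t - bounded_part t'| <= `|h (rho t) t - h (rho t') t'|.
  by rewrite /bounded_part -opprD normrN -scalerBr norm_half_le.
split; last first.
  have [N [d [_ H]]] := rot_Delta_equicontinuous J_up psi_cont hUC ltr01.
  exists N; split; rewrite ?num_real// => M NM t Jt /=.
  rewrite /bounded_part normrN (le_trans (norm_half_le _))// (le_trans _ (ltW NM))//.
  exact: (H _ _ (rho_gt0 t) (rho_le2 t) Jt).1.
apply/UCP => e e0; have e40 : 0 < e / 4 by rewrite divr_gt0.
have [N [d [d0 H]]] := rot_Delta_equicontinuous J_up psi_cont hUC e40.
have [eta eta0 K] := psi_slowly_varying J_up J0 psi_cont hUC e40.
exists (Num.min d (eta / 6)); first by rewrite lt_min d0 divr_gt0.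
move=> t t' Jt Jt'; rewrite lt_min => /andP[td te].
apply: le_lt_trans (dist t t') _.
rewrite (le_lt_trans (ler_distD (h (rho t) t') _ _))//.
have h1 := (H _ _ (rho_gt0 t) (rho_le2 t) Jt).2 _ Jt' td.
have -> : h (rho t) t' - h (rho t') t' =
    (frakg t')^-1 *: (psi (t' + rho t) - psi (t' + rho t')).
  by rewrite -scalerBr /Delta opprB addrA subrK.
have h2 : `|psi (t' + rho t) - psi (t' + rho t')| <= e / 4.
  apply: K; [by apply: J_up => //; exact/ltW/rho_gt0|exact: J_rho|].
  rewrite opprD addrACA subrr add0r.
  (* [1 + |t' + rho t| <= 3 * (1 + |t'|)] and the 2 of [rho_dist] produce the 6 in [eta / 6]. *)
  have aux (D a b c x r : R) : D < eta / 6 -> 0 <= a -> 0 <= b -> 0 <= c ->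
      r <= 2 -> x <= c + r -> a * (1 + b) * (1 + c) <= 2 * D -> a * (1 + x) <= eta.
    move=> De a0 b0 c0 r2 xr abc; have x3 : 1 + x <= 3 * (1 + c) by lra.
    have h3 : a * (1 + c) <= a * (1 + b) * (1 + c).
      by rewrite ler_wpM2r ?ler_peMr//; lra.
    by apply: le_trans (ler_wpM2l a0 x3) _; lra.
  apply: (aux _ _ _ _ _ _ te _ _ _ (rho_le2 t) _ (rho_dist t t')) => //.
  by rewrite -[rho t in leRHS]gtr0_norm ?rho_gt0// ler_normD.
have := norm_frakgV_le t' (psi (t' + rho t) - psi (t' + rho t')); lra.
Qed.

Lemma slow_part_continuous : continuous slow_part.
Proof.
have c1 : continuous (fun t => psi t + psi (pr t + rho (pr t))).
  move=> t; apply: cvgD; first exact: psi_cont.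
  apply: (@continuous_comp _ _ _ (fun t => pr t + rho (pr t))); last exact: psi_cont.
  apply: cvgD; first exact: pr_cont.
  by apply: continuous_comp (@pr_cont t) (@rho_continuous _ _).
apply/continuousP_dist => x e e0; have [d d0 K] := (continuousP_dist _).1 c1 x e e0.
exists d => // y xy; rewrite /slow_part -scalerBr.
by apply: le_lt_trans (norm_half_le _) _; exact: K.
Qed.

(** Twice [Delta r slow_part t] is a cancelling pair of increments by [r] plus the effect on [psi]
    of [rho t - rho (t + r)], which decays quadratically, faster than slow variation requires. *)
Lemma Delta_slow_part_C0 r : 0 < r -> C0 X J (Delta r slow_part).
Proof.
move=> r0; split.
  apply: continuous_subspaceT => t; apply: cvgB; last exact: slow_part_continuous.
  apply: (@continuous_comp _ _ _ (fun t => t + r)); last exact: slow_part_continuous.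
  by apply: cvgD; [exact: cvg_id|exact: cvg_cst].
move=> e e0; have e80 : 0 < e / 8 by rewrite divr_gt0.
have [N HN] := rot_Delta_bounded J_up hUC r0.
have N0 : 0 <= N by exact: le_trans (HN _ J0).
have N1 : 0 < N + 1 by rewrite ltr_pwDr.
have [d d0 K] := (UCP J (h r)).1 (hUC r0) _ e80.
have [eta eta0 L] := psi_slowly_varying J_up J0 psi_cont hUC e80.
have d'0 : 0 < Num.min d (e / (32 * (N + 1))).
  by rewrite lt_min d0 divr_gt0// mulr_gt0.
have [M HM] := rho_small d'0.
(* The point [y = t + rho t + r] satisfies [1 + |y| <= (3 + r) * (1 + |t|)], [rho_dist] contributes
   [2 * r], and the last [r] passes from [|t|] to [|t + r|]. *)
exists (Num.max M (2 * r * (3 + r) / eta + r)) => t Jt.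
rewrite gt_max => /andP[/ltW Mt tQ].
have := HM _ Mt; rewrite lt_min => /andP[rd re].
have Jtr : J (t + r) by apply: J_up => //; exact: ltW.
have -> : Delta r slow_part t = half R *: (
    (frakg t *: h r t + frakg (t + rho t) *: h r (t + rho t))
    + (psi (t + r + rho (t + r)) - psi (t + rho t + r))).
  rewrite /Delta /slow_part -scalerBr !pr_id// !frakg_rot_Delta; congr (_ *: _).
  set q := psi (t + rho t + r).
  by rewrite -[RHS]addrA (addrC (q - _)) subrKA opprD addrACA.
apply: le_lt_trans (norm_half_le _) _; apply: le_lt_trans (ler_normD _ _) _.
have h1 : `|frakg t *: h r t + frakg (t + rho t) *: h r (t + rho t)| <= e / 2.
  apply: le_trans (frakg_rho_cancel _ _ _) _.
  have k1 : `|h r (t + rho t) - h r t| < e / 8.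
    apply: K => //; first exact: J_rho.
    by rewrite addrAC subrr add0r gtr0_norm// rho_gt0.
  have k2 := HN _ Jt; have k3 := normr_ge0 (h r t); have k4 := rho_gt0 t.
  move: re; rewrite ltr_pdivlMr ?mulr_gt0//.
  by move: (rho t) `|h r t| `|_ - _| k1 k2 k3 k4 => p a b k1 k2 k3 k4 re; nra.
have h2 : `|psi (t + r + rho (t + r)) - psi (t + rho t + r)| <= e / 8.
  rewrite distrC; apply: L; [by apply: J_up; [exact: J_rho|exact: ltW]|exact: J_rho|].
  rewrite (_ : _ - _ = rho t - rho (t + r)); last by ring.
  have aux (a b p y D : R) : 2 * r * (3 + r) / eta + r < a -> 0 <= D -> 0 <= a ->
      p <= 2 -> a <= b + r -> y <= a + p + r -> D * (1 + a) * (1 + b) <= 2 * r ->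
      D * (1 + y) <= eta.
    rewrite -ltrBrDr ltr_pdivrMr// => aQ D0 a0 p2 ab yx Dab.
    have y3 : 1 + y <= (3 + r) * (1 + a) by nra.
    apply: le_trans (ler_wpM2l D0 y3) _.
    have b0 : 0 < 1 + b by nra.
    rewrite -(ler_pM2r b0).
    rewrite (_ : _ * _ * _ = (3 + r) * (D * (1 + a) * (1 + b))); last by ring.
    apply: (@le_trans _ _ ((3 + r) * (2 * r))); first by rewrite ler_pM2l//; lra.
    nra.
  apply: (aux _ `|t + r| (rho t) _ _ tQ) => //; first exact: rho_le2.
  - by have := ler_normB (t + r) r; rewrite addrK (gtr0_norm r0).
  - rewrite (le_trans (ler_normD _ _))// (gtr0_norm r0) lerD2r.
    by rewrite (le_trans (ler_normD _ _))// (gtr0_norm (rho_gt0 t)).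
  - have := rho_dist t (t + r).
    by rewrite (_ : `|t - (t + r)| = r)// opprD addrA subrr sub0r normrN gtr0_norm.
lra.
Qed.

End Decomposition.

(** * Local integrability of continuous functions *)

Section LocalIntegrability.
Variables (R : realType) (X : normedModType R).
Local Notation E := (complexification X).

Let clamp (n : nat) (t : R) : R := Num.max (- n%:R) (Num.min t n%:R).

(* Index of the grid cell of mesh [1 / (n + 1)] of [-n, n] that contains [t]. *)
Let cell (n : nat) (t : R) : nat := Num.truncn ((clamp n t + n%:R) * n.+1%:R).

Let node (n k : nat) : R := k%:R / n.+1%:R - n%:R.

Let clampD_ge0 n t : 0 <= clamp n t + n%:R.
Proof. by rewrite -lerBlDr sub0r le_max lexx. Qed.

Let cell_le n t : (cell n t <= (n + n) * n.+1)%N.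
Proof.
rewrite -(ler_nat R); apply: (@le_trans _ _ ((clamp n t + n%:R) * n.+1%:R)).
  by rewrite truncn_le mulr_ge0.
rewrite natrM ler_wpM2r// natrD lerD2r ge_max ge_min lexx orbT andbT.
by rewrite (@le_trans _ _ 0)// oppr_le0.
Qed.

Let cell_measurable n :
  measurable_fun setT (fun t : R => (cell n t)%:R : R).
Proof.
apply: measurable_realfun.nondecreasing_measurable => // s t st.
rewrite ler_nat le_truncn// ler_wpM2r// lerD2r.
by rewrite /clamp ge_max !le_max lexx /= le_min !ge_min st lexx !orbT.
Qed.

Let node_cell_dist n t : `|t| <= n%:R -> `|t - node n (cell n t)| <= n.+1%:R^-1.
Proof.
rewrite ler_norml => /andP[t1 t2].
have ct : clamp n t = t by rewrite /clamp (min_idPl t2) (max_idPr t1).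
have n0 : 0 < n.+1%:R :> R by rewrite ltr0n.
have h1 : (cell n t)%:R <= (t + n%:R) * n.+1%:R.
  by rewrite -{2}ct truncn_le mulr_ge0.
have h2 : (t + n%:R) * n.+1%:R < (cell n t)%:R + 1.
  by rewrite -{1}ct natr1 truncnS_gt.
have -> : t - node n (cell n t) = ((t + n%:R) * n.+1%:R - (cell n t)%:R) / n.+1%:R.
  by rewrite /node; field; rewrite gt_eqF.
rewrite normrM normfV (gtr0_norm n0) ger0_norm ?subr_ge0//.
by rewrite ler_pdivrMr// mulVf ?gt_eqF//; lra.
Qed.

(** [f] is sampled at the node of the cell of [t]. Clamping leaves finitely many cells, hence a
    finite range, and the mesh tends to 0, so continuity gives convergence at every point. *)
Lemma continuous_strongly_measurable (J : set R) (f : R -> E) :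
  continuous f -> strongly_measurable J f.
Proof.
move=> cf; exists (fun n t => f (node n (cell n t))) => [n|].
  split.
    apply: (@sub_finite_set _ _ ((f \o node n) @` `I_((n + n) * n.+1).+1)).
      by move=> _ [t _ <-]; exists (cell n t) => //=; rewrite ltnS.
    exact/finite_image/finite_II.
  move=> y; pose B := [set (k%:R : R) | k in
      [set k | (k <= (n + n) * n.+1)%N /\ f (node n k) = y]].
  rewrite (_ : _ @^-1` _ = (fun t => (cell n t)%:R) @^-1` B); last first.
    apply/seteqP; split => t /=; first by exists (cell n t).
    by move=> [k [_ <-] /eqP]; rewrite eqr_nat => /eqP ->.
  rewrite -[X in measurable X]setTI; apply: cell_measurable => //.
  apply: countable_measurable.
    by move=> z; exact: measurable_set1.
  apply: finite_set_countable; apply: finite_image.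
  by apply: (@sub_finite_set _ _ `I_((n + n) * n.+1).+1) => [k []|]; rewrite ?ltnS.
apply: aeW => t _; apply/cvgrPdist_lt => e e0.
have [d d0 K] := (continuousP_dist f).1 cf t e e0.
exists (Num.truncn `|t| + Num.truncn d^-1).+1 => // n /= nt.
apply: K; apply: le_lt_trans (node_cell_dist _) _.
  rewrite (le_trans (ltW (truncnS_gt _)))// ler_nat (leq_trans _ nt)// ltnS.
  exact: leq_addr.
rewrite invf_plt ?posrE// (lt_le_trans (truncnS_gt _))// ler_nat ltnS.
by rewrite (leq_trans _ (ltnW nt))// leq_addl.
Qed.

Lemma continuous_L1loc (J : set R) (f : R -> E) : continuous f -> L1loc X J f.
Proof.
move=> cf; split; first exact: continuous_strongly_measurable.
move=> K cK _.
have /integrableP[_] : lebesgue_measure.-integrable K (EFin \o (fun t => `|f t|)).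
  apply: continuous_compact_integrable => //; apply: continuous_subspaceT => t.
  by apply: continuous_comp (cf t) (@norm_continuous _ _ _).
by under eq_integral do rewrite /= normr_id.
Qed.

End LocalIntegrability.

(** * From the two summands back to uniform continuity *)

Section Converse.
Variables (R : realType) (X : normedModType R) (J : set R) (pr : R -> R).
Local Notation E := (complexification X).
Hypothesis J_up : forall t s : R, J t -> 0 <= s -> J (t + s).
Hypothesis pr_cont : continuous pr.
Hypothesis prJ : forall t, J (pr t).
Hypothesis pr_id : forall t, J t -> pr t = t.

(** The factor turns ever faster, but far out both values are small, and on a segment compactness
    applies. With [|x - y| < 1], [|x| > M + 1] forces [|y| > M]. *)
Lemma C0_frakgV_UC (c : R -> E) :
  C0 X J c -> UC X J (fun t => (frakg t)^-1 *: c t).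
Proof.
move=> [cc c0]; pose F t := expi (- pr t ^+ 2) *: (c \o pr) t.
have Fc : continuous F.
  apply: continuous_expi_scale => [t|]; last exact: (continuous_pr pr_cont prJ cc).
  apply: cvgN; apply: continuous_comp (@pr_cont t) (@exprn_continuous _ 2 _).
have FE t : J t -> (frakg t)^-1 *: c t = F t by move=> Jt; rewrite /F /= pr_id// frakgV.
apply/UCP => e e0; have e40 : 0 < e / 4 by rewrite divr_gt0.
have [M HM] := c0 _ e40.
have [d d0 K] := continuous_unif_on_segment (M + 1) Fc e0.
exists (Num.min d 1); first by rewrite lt_min d0 ltr01.
move=> x y Jx Jy; rewrite lt_min => /andP[xd x1].
have [xM|Mx] := leP `|x| (M + 1); first by rewrite !FE//; exact: K.
have My : M < `|y| by have := lerB_dist x y; lra.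
have h1 : `|c x| < e / 4 by apply: HM => //; lra.
have h2 := HM _ Jy My.
rewrite (le_lt_trans (ler_normB _ _))//.
by have := norm_frakgV_le x (c x); have := norm_frakgV_le y (c y); lra.
Qed.

(** For fixed [s] the phase [s ^+ 2 + 2 * s * t] is Lipschitz in [t], so rotating bounded values
    keeps uniform continuity. *)
Lemma BUC_T_UC (u : R -> E) s : 0 < s -> BUC X J u -> UC X J (T_op u s).
Proof.
move=> s0 [uu [N0 [_ bu]]].
pose N := `|N0| + 1; have NN0 : N0 < N by rewrite (le_lt_trans (ler_norm _))// ltrDl.
have N_gt0 : 0 < N by rewrite ltr_wpDl.
apply/UCP => e e0; have e60 : 0 < e / 6 by rewrite divr_gt0.
have [d d0 K] := (UCP J u).1 uu _ e60.
exists (Num.min d (e / (12 * s * N))); first by rewrite lt_min d0 divr_gt0// !mulr_gt0.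
move=> x y Jx Jy; rewrite lt_min => /andP[xd]; rewrite ltr_pdivlMr ?mulr_gt0// => xe.
have Js t : J t -> J (s + t) by move=> Jt; rewrite addrC; apply: J_up => //; exact: ltW.
have h1 : `|u (s + x) - u (s + y)| < e / 6.
  by apply: K; [exact: Js..|rewrite opprD addrACA subrr add0r].
have h2 := K _ _ Jx Jy xd.
have h3 : `|u (s + y)| <= N by exact: (bu _ NN0 _ (Js _ Jy)).
rewrite /T_op opprD opprK addrACA (le_lt_trans (ler_normD _ _))//.
have := norm_expi_dist_le (s ^+ 2 + 2 * s * x) (s ^+ 2 + 2 * s * y)
  (u (s + x)) (u (s + y)).
rewrite opprD addrACA subrr add0r -mulrBr normrM gtr0_norm ?mulr_gt0// => h4.
rewrite (_ : - u x + u y = - (u x - u y)); last by rewrite opprB addrC.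
rewrite normrN.
have h5 : 2 * (2 * s * `|x - y|) * `|u (s + y)| <= 2 * (2 * s * `|x - y|) * N.
  by rewrite ler_wpM2l// !mulr_ge0// ltW.
have h6 : 3 * (2 * (2 * s * `|x - y|) * N) = `|x - y| * (12 * s * N) by ring.
lra.
Qed.

End Converse.

(** * Inclusions between the three spaces *)

Section Equalities.
Variables (R : realType) (X : normedModType R) (J : set R) (pr : R -> R).
Local Notation E := (complexification X).
Hypothesis J_up : forall t s : R, J t -> 0 <= s -> J (t + s).
Hypothesis J0 : J 0.
Hypothesis pr_cont : continuous pr.
Hypothesis prJ : forall t, J (pr t).
Hypothesis pr_id : forall t, J t -> pr t = t.

(** The function [psi] of the argument, composed with [pr] so that it depends only on [phi] on
    [J]. *)
Let lift (phi : R -> E) (t : R) : E := frakg (pr t) *: phi (pr t).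

Let lift_pr phi t : lift phi (pr t) = lift phi t.
Proof. by rewrite /lift pr_id. Qed.

Let rot_Delta_lift phi s t : 0 < s -> J t -> rot_Delta (lift phi) s t = T_op phi s t.
Proof.
move=> s0 Jt; have Jts : J (t + s) by apply: J_up => //; exact: ltW.
by rewrite T_opE /rot_Delta /Delta /lift !pr_id.
Qed.

Let rot_Delta_UC phi : G_space X J phi ->
  forall s : R, 0 < s -> UC X J (rot_Delta (lift phi) s).
Proof.
move=> Gphi s s0; apply: eq_on_UC (Gphi s s0) => t Jt.
by rewrite rot_Delta_lift.
Qed.

Lemma G_space_sub_G_BUC_space : G_space X J `<=` G_BUC_space X J.
Proof.
move=> phi Gphi s s0; split; first exact: Gphi.
have [N HN] := rot_Delta_bounded J_up (rot_Delta_UC Gphi) s0.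
exists N; split; rewrite ?num_real// => M NM t Jt /=.
by rewrite -rot_Delta_lift// (le_trans (HN _ Jt))// ltW.
Qed.

Lemma G_space_sub_fun_sum :
  G_space X J `<=` fun_sum J (BUC X J) (DeltaC0_div_frakg X J).
Proof.
move=> phi /rot_Delta_UC hUC; pose xi := slow_part pr (lift phi).
exists (bounded_part (lift phi)), (fun t => (frakg t)^-1 *: xi t); split.
- exact: (bounded_part_BUC J_up J0 pr_cont prJ pr_id (lift_pr phi) hUC).
- exists xi => //; split.
    apply: continuous_L1loc.
    exact: (slow_part_continuous J_up J0 pr_cont prJ pr_id (lift_pr phi) hUC).
  exact: (Delta_slow_part_C0 J_up J0 pr_cont prJ pr_id (lift_pr phi) hUC).
- move=> t Jt; rewrite -(bounded_slow_partE pr_id)//.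
  by rewrite /lift pr_id// scalerK// expi_neq0.
Qed.

(** [T_op] is additive, and on [xi / frakg] it gives [Delta s xi / frakg], to which [C0_frakgV_UC]
    applies. *)
Lemma fun_sum_sub_G_space :
  fun_sum J (BUC X J) (DeltaC0_div_frakg X J) `<=` G_space X J.
Proof.
move=> phi [u [v [Bu [xi [_ xiC0] vE] phiE]]] s s0.
have Js t : J t -> J (s + t) by move=> Jt; rewrite addrC; apply: J_up => //; exact: ltW.
apply: (@eq_on_UC _ _ _ (fun t => T_op u s t + (frakg t)^-1 *: Delta s xi t)).
  move=> t Jt; rewrite T_opE -scalerDr [RHS]T_opE; congr (_ *: _).
  have Jts : J (t + s) by rewrite addrC; exact: Js.
  rewrite /Delta !phiE// !vE// !scalerDr !scalerA !mulfV ?expi_neq0// !scale1r.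
  by rewrite opprD [RHS]addrACA.
have /UCP uT := BUC_T_UC J_up s0 Bu.
have /UCP uxi := C0_frakgV_UC pr_cont prJ pr_id (xiC0 s s0).
apply/UCP => e e0; have e20 : 0 < e / 2 by rewrite divr_gt0.
have [d1 d10 K1] := uT _ e20; have [d2 d20 K2] := uxi _ e20.
exists (Num.min d1 d2); first by rewrite lt_min d10.
move=> x y Jx Jy; rewrite lt_min => /andP[x1 x2].
rewrite opprD addrACA (le_lt_trans (ler_normD _ _))// (splitr e).
by rewrite ltrD//; [exact: K1|exact: K2].
Qed.

End Equalities.

Unset Implicit Arguments.
Set Strict Implicit.

Theorem theorem3p5 (R : realType) (X : completeNormedModType R) (J : set R)
    (hJ : J = `[0, +oo[%classic \/ J = setT) :
  G_space X J = fun_sum J (BUC X J) (DeltaC0_div_frakg X J) /\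
  fun_sum J (BUC X J) (DeltaC0_div_frakg X J) = G_BUC_space X J.
Proof.
(* Both choices of [J] contain 0, are stable under forward shifts and admit a continuous retraction:
   [max 0] or the identity. *)
have [pr [J_up J0 pr_cont prJ pr_id]] : exists pr : R -> R,
  [/\ forall t s : R, J t -> 0 <= s -> J (t + s), J 0, continuous pr,
      forall t, J (pr t) & forall t, J t -> pr t = t].
  case: hJ => ->; last by exists id; split => // t; exact: cvg_id.
  exists (Num.max 0); split => [t s| |t|t|t]; rewrite /= ?in_itv/= ?andbT ?le_max ?lexx//.
  - exact: addr_ge0.
  - by apply: continuous_max; [exact: cvg_cst|exact: cvg_id].
  - exact: max_r.
have GS := G_space_sub_fun_sum J_up J0 pr_cont prJ pr_id (X := X).
have SG := fun_sum_sub_G_space J_up pr_cont prJ pr_id (X := X).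
have GB := G_space_sub_G_BUC_space J_up pr_id (X := X).
have BG : G_BUC_space X J `<=` G_space X J by move=> phi H s /H[].
by split; apply/seteqP; split => // phi; [move=> /SG/GB|move=> /BG/GS].
Qed.
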